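(* Consider the transformed grad-div saddle-point matrix $$\mathcal{A}=\begin{pmatrix}\mathsf{M}_\beta&\mathsf{D}^{T}\\ \mathsf{D}&-\mathsf{W}_\alpha^{-1}\end{pmatrix},$$ with (negative) Schur complement $\mathsf{S}=\mathsf{W}_\alpha^{-1}+\mathsf{D}\mathsf{M}_\beta^{-1}\mathsf{D}^{T}$. Let $\widetilde{\mathsf{M}}$ denote the diagonal of $\mathsf{M}_\beta$, and let $\widehat{\mathsf{S}}$ be a symmetric positive-definite matrix spectrally equivalent to $\mathsf{S}$, with constants independent of the mesh size $h$ and the polynomial degree $p$. Let $$\mathcal{B}=\begin{pmatrix}\widetilde{\mathsf{M}}&0\\0&\widehat{\mathsf{S}}\end{pmatrix}.$$ Then $\mathcal{B}^{-1}\mathcal{A}$ is uniformly well conditioned: there is a constant $K$, independent of the mesh size $h$ and the polynomial degree $p$, such that $\kappa(\mathcal{B}^{-1}\mathcal{A})\le K$.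
   Context: Setting: $d\in\{2,3\}$, $\Omega\subset\mathbb{R}^d$, $p\ge1$. $\mathcal{T}$ is a conforming mesh of $\Omega$ by quadrilaterals ($d=2$) or hexahedra ($d=3$), of mesh size $h$; each $\kappa\in\mathcal{T}$ is the image $T_\kappa([0,1]^d)$ of the unit cube under a transformation $T_\kappa$ with Jacobian $J_\kappa$, $\det J_\kappa>0$. The coefficients $\alpha,\beta$ are scalar functions on $\Omega$ such that $\mathsf{W}_\alpha$ and $\mathsf{M}_\beta$ below are positive-definite. All objects depend on the mesh $\mathcal T$ and on $p$; ''uniform'' refers to the family of meshes and degrees under consideration. Spaces: $\boldsymbol{V}_h$ is the degree-$p$ Raviart--Thomas space: all $\boldsymbol v\in\boldsymbol H(\mathrm{div};\Omega)$ whose restriction to each $\kappa$ is the Piola image $\det(J_\kappa)^{-1}J_\kappa\hat{\boldsymbol v}$ of some $\hat{\boldsymbol v}$ in $\mathcal{Q}_{p,p-1,p-1}\times\mathcal{Q}_{p-1,p,p-1}\times\mathcal{Q}_{p-1,p-1,p}$ ($d=3$; analogously $\mathcal{Q}_{p,p-1}\times\mathcal{Q}_{p-1,p}$ for $d=2$), where $\mathcal{Q}_{p_1,p_2,p_3}$ denotes polynomials of degree at most $p_i$ in $x_i$. $W_h$ is the space of $w\in L^2(\Omega)$ whose restriction to each $\kappa$ is $\det(J_\kappa)^{-1}\hat w$ with $\hat w\in\mathcal{Q}_{p-1}$ (degree at most $p-1$ in each variable). Interpolation--histopolation basis: the reference cube $[0,1]^d$ is subdivided into $p^d$ box subelements with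 vertices at the $d$-fold Cartesian product of the $p+1$ Gauss--Lobatto points on $[0,1]$; mapping by the $T_\kappa$ gives a subelement mesh of $\Omega$. The degrees of freedom of $\boldsymbol{V}_h$ are the integrals of the normal component over each subelement face (with a fixed choice of normal for each face); the degrees of freedom of $W_h$ are the integrals over each subelement volume. The bases are those dual to these degrees of freedom. Matrices: with vectors of coefficients $\mathsf u,\mathsf v$ of $\boldsymbol u,\boldsymbol v\in\boldsymbol V_h$ and $\mathsf q,\mathsf r$ of $q,r\in W_h$ in these bases, define $\mathsf v^T\mathsf M_\beta\mathsf u=\int_\Omega\beta\,\boldsymbol u\cdot\boldsymbol v$ and $\mathsf r^T\mathsf W_\alpha\mathsf q=\int_\Omega\alpha\,q\,r$. $\mathsf D$ is the matrix of $\nabla\cdot:\boldsymbol V_h\to W_h$. Spectral equivalence: symmetric positive-definite matrices $\mathsf X,\mathsf Y$ (depending on $h,p$) are spectrally equivalent if there are constants $c_0,c_1>0$ independent of $h$ and $p$ with $c_0\,\mathsf x^T\mathsf Y\mathsf x\le\mathsf x^T\mathsf X\mathsf x\le c_1\,\mathsf x^T\mathsf Y\mathsf x$ for all vectors $\mathsf x$. Standing fact (property of the basis, known from earlier work and taken for granted): $\mathsf M_\beta$ is spectrally equivalent to its diagonal $\widetilde{\mathsf M}$, with constants independent of $h$ and $p$. Condition number: for symmetric $\mathcal{A}$ and symmetric positive-definite $\mathcal{B}$, $\kappa(\mathcal{B}^{-1}\mathcal{A})=|\lambda|_{\max}/|\lambda|_{\min}$, the ratio of the largest to the smallest absolute value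 of the (real) eigenvalues of $\mathcal{B}^{-1}\mathcal{A}$. *)

(* Defs.v *)
From HB Require Import structures.
From mathcomp Require Import all_boot all_order all_algebra.
From mathcomp Require Import all_classical all_reals all_analysis.
From mathcomp Require Import perm.
From mathcomp.real_closed Require polyrcf.

Set Implicit Arguments.
Unset Strict Implicit.
Unset Printing Implicit Defensive.

Import Order.TTheory GRing.Theory Num.Theory.
Import numFieldNormedType.Exports.

Local Open Scope classical_set_scope.
Local Open Scope ring_scope.

Lemma sigma_finite_product d1 d2 (T1 : measurableType d1)
    (T2 : measurableType d2) (R : realType)
    (m1 : {sigma_finite_measure set T1 -> \bar R})
    (m2 : {sigma_finite_measure set T2 -> \bar R}) :
  sigma_finite setT (m1 \x m2)%E.
Proof.
have /sigma_finiteP[F [TF ndF Foo]] := sigma_finiteT m1.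
have /sigma_finiteP[G [TG ndG Goo]] := sigma_finiteT m2.
exists (fun n => F n `*` G n).
  rewrite -setXTT TF TG predeqE => -[x y]; split.
    move=> [/= [n _ Fnx] [k _ Gky]]; exists (maxn n k) => //; split.
    - by move: x Fnx; exact/subsetPset/ndF/leq_maxl.
    - by move: y Gky; exact/subsetPset/ndG/leq_maxr.
  by move=> [n _ []/= ? ?]; split; exists n.
move=> k; have [? ?] := Foo k; have [? ?] := Goo k.
split; first exact: measurableX.
by rewrite product_measure1E// lte_mul_pinfty// ge0_fin_numE.
Qed.

(* Lebesgue measure on n-tuples, as the image of the product of the
   one-dimensional Lebesgue measure and the measure on (n-1)-tuples. *)
Section lebesgue_cons.
Context (R : realType) (n : nat).
Local Notation Rm := (measurableTypeR R).
Variable mu : {sigma_finite_measure set (n.-tuple Rm) -> \bar R}.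

Let cons (z : Rm * n.-tuple Rm) : n.+1.-tuple Rm := [tuple of z.1 :: z.2].

Let measurable_fun_cons : measurable_fun setT cons.
Proof. exact: measurable_cons. Qed.

Definition lebesgue_cons : set (n.+1.-tuple Rm) -> \bar R :=
  pushforward (lebesgue_measure \x mu)%E cons.

Let lebesgue_cons0 : lebesgue_cons set0 = 0%E.
Proof. by rewrite /lebesgue_cons /pushforward preimage_set0 measure0. Qed.

Let lebesgue_cons_ge0 A : (0 <= lebesgue_cons A)%E.
Proof. exact: measure_ge0. Qed.

Let lebesgue_cons_sigma_additive : semi_sigma_additive lebesgue_cons.
Proof.
have m1 A : measurable A -> measurable (cons @^-1` A).
  by move=> mA; rewrite -[X in measurable X]setTI; exact: measurable_fun_cons.
move=> F mF tF mUF; rewrite /lebesgue_cons /pushforward preimage_bigcup.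
apply: measure_semi_sigma_additive.
- by move=> i; exact: m1.
- apply/trivIsetP => /= i j _ _ ij; rewrite -preimage_setI.
  by move/trivIsetP : tF => /(_ _ _ _ _ ij) ->//; rewrite preimage_set0.
- by rewrite -preimage_bigcup; exact: m1.
Qed.

HB.instance Definition _ := isMeasure.Build _ _ _ lebesgue_cons
  lebesgue_cons0 lebesgue_cons_ge0 lebesgue_cons_sigma_additive.

Let lebesgue_cons_sigma_finite : sigma_finite setT lebesgue_cons.
Proof.
have [F FT Foo] := sigma_finite_product lebesgue_measure mu.
pose uncons (t : n.+1.-tuple Rm) : Rm * n.-tuple Rm :=
  (thead t, [tuple of behead t]).
have consK : cancel cons uncons.
  by case=> x t; rewrite /uncons/= theadE; congr pair; exact/val_inj.
have unconsK : cancel uncons cons.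
  by move=> t; rewrite /cons/= [RHS]tuple_eta.
have muncons : measurable_fun setT uncons.
  apply: measurable_fun_pair; last exact: measurable_behead.
  exact: measurable_tnth.
exists (fun i => uncons @^-1` F i).
  by rewrite -preimage_bigcup -FT preimage_setT.
move=> i; have [mF Fi] := Foo i; split.
  by rewrite -[X in measurable X]setTI; exact: muncons.
rewrite /lebesgue_cons /pushforward (_ : _ @^-1` _ = F i)//.
by apply/seteqP; split => z /=; rewrite consK.
Qed.

HB.instance Definition _ := Measure_isSigmaFinite.Build _ _ _ lebesgue_cons
  lebesgue_cons_sigma_finite.

End lebesgue_cons.

Fixpoint lebesgue_measureN (R : realType) (n : nat) :
    {sigma_finite_measure set (n.-tuple (measurableTypeR R)) -> \bar R} :=
  match n with
  | 0 => \d_([tuple] : 0.-tuple (measurableTypeR R))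
  | n'.+1 => lebesgue_cons (lebesgue_measureN R n')
  end.

(* Points of R^n are row vectors, which carry the normed topology and the
   differential calculus of the library; n-tuples carry its sigma-algebra.
   Functions and sets are transported along rvec for integration. *)
Section integration.
Context (R : realType) (n : nat).
Implicit Types (D : set 'rV[R]_n) (f : 'rV[R]_n -> R).

Definition rvec (t : n.-tuple (measurableTypeR R)) : 'rV[R]_n :=
  \row_i tnth t i.

Definition integralN D f : R :=
  Rintegral (lebesgue_measureN R n) (rvec @^-1` D) (f \o rvec).

Definition L2 D f : Prop :=
  ((f \o rvec) \_ (rvec @^-1` D)) \in Lfun (lebesgue_measureN R n) 2%:E.

End integration.

Section weak_divergence.
Context (R : realType) (d : nat) (Omega : set 'rV[R]_d).
Implicit Types (f g : 'rV[R]_d -> R) (v : 'rV[R]_d -> 'rV[R]_d).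

Definition partial (j : 'I_d) f : 'rV[R]_d -> R :=
  fun x => 'D_(delta_mx 0 j) f x.

Definition smooth f : Prop :=
  forall (s : seq 'I_d) (x : 'rV[R]_d), differentiable (foldr partial f s) x.

Definition test_function f : Prop :=
  smooth f /\
  exists C : set 'rV[R]_d,
    [/\ compact C, C `<=` Omega & forall x, ~ C x -> f x = 0].

Definition weak_div v g : Prop :=
  forall f, test_function f ->
    integralN Omega (fun x => \sum_j v x 0 j * partial j f x) =
    - integralN Omega (fun x => g x * f x).

Definition Hdiv : set ('rV[R]_d -> 'rV[R]_d) :=
  [set v : 'rV[R]_d -> 'rV[R]_d |
     (forall j, L2 Omega (fun x => v x 0 j)) /\
     exists2 g, L2 Omega g & weak_div v g].

End weak_divergence.

Section reference_element.
Context (R : realType) (d : nat).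

Definition cube : set 'rV[R]_d :=
  [set x : 'rV[R]_d | forall i, x 0 i \in `[0, 1]].

(* A closed face of the cube, of any dimension: c i = Some b fixes the i-th
   coordinate to b, and c i = None leaves it free. *)
Definition cube_face (c : 'I_d -> option bool) : set 'rV[R]_d :=
  [set x : 'rV[R]_d | cube x /\ forall i b, c i = Some b -> x 0 i = b%:R].

Definition cube_symmetry (s : {perm 'I_d}) (e : 'I_d -> bool) (x : 'rV[R]_d)
    : 'rV[R]_d :=
  \row_i (if e i then 1 - x 0 (s i) else x 0 (s i)).

(* Q_{r_1,...,r_d}: degree at most r i in the i-th variable. *)
Definition Qpoly (r : 'I_d -> nat) : set ('rV[R]_d -> R) :=
  [set q : 'rV[R]_d -> R |
     exists c : {dffun forall i : 'I_d, 'I_(r i).+1} -> R,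
       q = fun x : 'rV[R]_d =>
             \sum_(a : {dffun forall i : 'I_d, 'I_(r i).+1})
                c a * \prod_i x 0 i ^+ (a i)].

Definition RT_ref (p : nat) : set ('rV[R]_d -> 'rV[R]_d) :=
  [set v : 'rV[R]_d -> 'rV[R]_d |
     forall i, Qpoly (fun j => if j == i then p else p.-1)
                     (fun x => v x 0 i)].

(* The p+1 Gauss-Lobatto points of [0,1] are 0, 1 and the zeros of the
   derivative of the Legendre polynomial shifted to [0,1]; by Rodrigues'
   formula the latter is, up to a constant factor, the p-th derivative of
   (X^2 - X)^p.  rootsR lists the real roots in increasing order. *)
Definition gauss_lobatto (p : nat) : nat -> R :=
  nth 0 (polyrcf.rootsR
    (('X^2 - 'X) * (('X^2 - 'X) ^+ p)^`(p.+1) : {poly R})).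

Definition subbox (p : nat) (m : {ffun 'I_d -> 'I_p}) : set 'rV[R]_d :=
  [set x : 'rV[R]_d | forall i,
     x 0 i \in `[gauss_lobatto p (m i), gauss_lobatto p (m i).+1]].

(* The subelement face orthogonal to the i-th axis; m i is the index of a node,
   and m j, for j != i, that of a subinterval, whence valid_subface. *)
Definition subface (p : nat) (i : 'I_d) (m : {ffun 'I_d -> 'I_p.+1})
    : set 'rV[R]_d :=
  [set x : 'rV[R]_d | x 0 i = gauss_lobatto p (m i) /\
     forall j, j != i ->
       x 0 j \in `[gauss_lobatto p (m j), gauss_lobatto p (m j).+1]].

Definition valid_subface (p : nat) (i : 'I_d) (m : {ffun 'I_d -> 'I_p.+1})
    : Prop :=
  forall j, j != i -> (m j < p)%N.

Definition insert_coord (i : 'I_d) (c : R) (t : 'rV[R]_d.-1) : 'rV[R]_d :=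
  \row_j (if unlift i j is Some l then t 0 l else c).

End reference_element.

(* Vectors are rows and 'D_w T x = w *m jacobian T x, so jacobian T x is the
   transpose of the usual Jacobian matrix. *)
Section transformation.
Context (R : realType) (d : nat) (T : 'rV[R]_d -> 'rV[R]_d).

Definition piola (vh : 'rV[R]_d -> 'rV[R]_d) (x : 'rV[R]_d) : 'rV[R]_d :=
  (\det (jacobian T x))^-1 *: (vh x *m jacobian T x).

(* The trace at T x, from inside the element T(cube), of a field v that is
   defined up to its values on element boundaries. *)
Definition inner_trace (v : 'rV[R]_d -> 'rV[R]_d) (x : 'rV[R]_d) : 'rV[R]_d :=
  lim (v (T y) @[y --> within (interior (@cube R d)) (nbhs x)]).

(* det(J) J^{-T} e_i: the normal of the image of {x_i = const}, whose Euclidean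
   length is the surface element with respect to the other coordinates. *)
Definition area_normal (i : 'I_d) (x : 'rV[R]_d) : 'rV[R]_d :=
  (col i (\adj (jacobian T x)))^T.

(* The integral of the normal component over T(subface i m), for the normal
   in the direction of increasing x_i. *)
Definition flux (p : nat) (i : 'I_d) (m : {ffun 'I_d -> 'I_p.+1})
    (v : 'rV[R]_d -> 'rV[R]_d) : R :=
  let X := insert_coord i (gauss_lobatto R p (m i)) in
  integralN (X @^-1` subface i m)
    (fun t => \sum_j inner_trace v (X t) 0 j * area_normal i (X t) 0 j).

End transformation.

(* Conformity includes the agreement of the parametrizations of a shared face,
   up to a symmetry of the cube; without it the images of the Gauss-Lobatto
   subdivisions would not match across elements. *)
Record mesh (R : realType) (d : nat) (Omega : set 'rV[R]_d) := Mesh {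
  elem : finType;
  trans : elem -> 'rV[R]_d -> 'rV[R]_d;
  trans_diff : forall k x, cube x -> differentiable (trans k) x;
  trans_C1 : forall k, {within @cube R d, continuous (jacobian (trans k))};
  trans_det : forall k x, cube x -> 0 < \det (jacobian (trans k) x);
  trans_inj : forall k, set_inj (@cube R d) (trans k);
  mesh_domain : Omega = interior (\bigcup_k (trans k @` @cube R d));
  mesh_conforming : forall k l, k != l ->
    trans k @` @cube R d `&` trans l @` @cube R d = set0 \/
    exists c s e,
      [/\ exists i, c i <> None,
          trans k @` @cube R d `&` trans l @` @cube R d =
            trans k @` @cube_face R d c &
          forall x, cube_face c x ->
            trans l (cube_symmetry s e x) = trans k x] }.

Section spaces.
Context (R : realType) (d : nat) (Omega : set 'rV[R]_d) (T : mesh Omega).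
Variable p : nat.

Definition RT_space : set ('rV[R]_d -> 'rV[R]_d) :=
  [set v : 'rV[R]_d -> 'rV[R]_d | Hdiv Omega v /\
     forall k : elem T, exists2 vh, RT_ref p vh &
       forall x, interior (@cube R d) x ->
         v (trans k x) = piola (trans k) vh x].

Definition W_space : set ('rV[R]_d -> R) :=
  [set w : 'rV[R]_d -> R | L2 Omega w /\
     forall k : elem T, exists2 wh, Qpoly (fun=> p.-1) wh &
       forall x, interior (@cube R d) x ->
         w (trans k x) = (\det (jacobian (trans k) x))^-1 * wh x].

Definition local_face : Type := (elem T * 'I_d * {ffun 'I_d -> 'I_p.+1})%type.

Definition valid_face (F : local_face) : Prop := valid_subface F.1.2 F.2.

Definition face_set (F : local_face) : set 'rV[R]_d :=
  trans F.1.1 @` @subface R d p F.1.2 F.2.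

Definition face_flux (F : local_face) (v : 'rV[R]_d -> 'rV[R]_d) : R :=
  flux (trans F.1.1) F.1.2 F.2 v.

Definition local_vol : Type := (elem T * {ffun 'I_d -> 'I_p})%type.

Definition vol_integral (V : local_vol) (w : 'rV[R]_d -> R) : R :=
  integralN (trans V.1 @` @subbox R d p V.2) w.

End spaces.

(* A mesh, a degree, a numbering of the subelement faces and volumes, a choice
   of normals and the interpolation-histopolation bases.  A face shared by two
   elements is listed once, through one of its two local descriptions. *)
Record discretization (R : realType) (d : nat) (Omega : set 'rV[R]_d) :=
    Discretization {
  dmesh :> mesh Omega;
  deg : nat;
  deg_ge1 : (1 <= deg)%N;
  nface : nat;
  face : 'I_nface -> local_face dmesh deg;
  face_valid : forall f, valid_face (face f);
  face_inj : injective (fun f => face_set (face f));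
  face_cover : forall F : local_face dmesh deg, valid_face F ->
    exists f, face_set (face f) = face_set F;
  normal_sign : 'I_nface -> bool;
  nvol : nat;
  vol : 'I_nvol -> local_vol dmesh deg;
  vol_bij : bijective vol;
  rt_basis : 'I_nface -> 'rV[R]_d -> 'rV[R]_d;
  rt_basis_in : forall f, RT_space dmesh deg (rt_basis f);
  rt_basis_dual : forall f g,
    (-1) ^+ normal_sign f * face_flux (face f) (rt_basis g) = (f == g)%:R;
  w_basis : 'I_nvol -> 'rV[R]_d -> R;
  w_basis_in : forall V, W_space dmesh deg (w_basis V);
  w_basis_dual : forall V U, vol_integral (vol V) (w_basis U) = (V == U)%:R }.

Section fe_matrices.
Context (R : realType) (d : nat) (Omega : set 'rV[R]_d).
Variable (h : discretization Omega).

Definition rt_mass (beta : 'rV[R]_d -> R) : 'M[R]_(nface h) :=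
  \matrix_(f, g) integralN Omega
    (fun x => beta x * \sum_j rt_basis g x 0 j * rt_basis f x 0 j).

Definition w_mass (alpha : 'rV[R]_d -> R) : 'M[R]_(nvol h) :=
  \matrix_(V, U) integralN Omega
    (fun x => alpha x * w_basis U x * w_basis V x).

Definition is_div_matrix (D : 'M[R]_(nvol h, nface h)) : Prop :=
  forall f, weak_div Omega (@rt_basis _ _ _ h f)
                     (fun x => \sum_V D V f * w_basis V x).

End fe_matrices.

Section matrices.
Context (R : realType).

Definition quad n (X : 'M[R]_n) (x : 'cV[R]_n) : R := (x^T *m X *m x) 0 0.

Definition spd n (X : 'M[R]_n) : Prop :=
  X^T = X /\ forall x : 'cV[R]_n, x != 0 -> 0 < quad X x.

(* The index i ranges over the discretizations under consideration, so the
   constants depend neither on the mesh nor on the degree. *)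
Definition spectrally_equivalent (I : Type) (n : I -> nat)
    (X Y : forall i, 'M[R]_(n i)) : Prop :=
  exists c0 c1 : R, [/\ 0 < c0, 0 < c1 &
    forall i (x : 'cV[R]_(n i)),
      c0 * quad (Y i) x <= quad (X i) x <= c1 * quad (Y i) x].

Definition diagonal_part n (X : 'M[R]_n) : 'M[R]_n :=
  diag_mx (\row_i X i i).

Definition saddle n m (M : 'M[R]_n) (W : 'M[R]_m) (D : 'M[R]_(m, n))
    : 'M[R]_(n + m) :=
  block_mx M D^T D (- invmx W).

Definition schur n m (M : 'M[R]_n) (W : 'M[R]_m) (D : 'M[R]_(m, n))
    : 'M[R]_m :=
  invmx W + D *m invmx M *m D^T.

(* The ratio of the extreme absolute values of the (real) eigenvalues; it is
   infinite for a singular matrix, so that a finite bound entails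
   nonsingularity. *)
Definition condition_number n (X : 'M[R]_n) : \bar R :=
  let S := [set `|a| | a in [set a | eigenvalue X a]] in
  if eigenvalue X 0 then +oo%E else (sup S / inf S)%:E.

End matrices.

(* Main.v *)
(** Write an eigenpair of the preconditioned matrix as
    [M x + D^T y = l Mt x], [D x - W^-1 y = l Sh y] and put [t = M^-1 D^T y],
    [r = x + t], so that [t^T M t <= y^T S y].  Testing with [(x, y)] gives
    [l (x^T Mt x + y^T Sh y) = x^T M x + 2 t^T M x - y^T W^-1 y], which bounds
    [|l|] from above by Young's inequality.  The equations also read
    [M r = l Mt x], [D r - S y = l Sh y]; testing them with [r + t] and [- y]
    gives [r^T M r + y^T S y = l ((r + t)^T Mt x - y^T Sh y)], where the factor
    of [l] is controlled by the left-hand side: this bounds [|l|] from below. *)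
Require Import Defs.
From mathcomp Require Import all_boot all_order all_algebra.
From mathcomp Require Import all_classical all_reals all_analysis.
From mathcomp Require Import ring lra.
Set Implicit Arguments.
Unset Strict Implicit.
Unset Printing Implicit Defensive.
Import Order.TTheory GRing.Theory Num.Theory.
Local Open Scope classical_set_scope.
Local Open Scope ring_scope.

(** * Bilinear and quadratic forms of real matrices *)

Section quadratic_forms.
Context (R : realType).

(** Rectangular [X] is allowed so that [D] can pair a [y] with an [x]. *)
Definition bilin m n (X : 'M[R]_(m, n)) (x : 'cV[R]_m) (y : 'cV[R]_n) : R :=
  (x^T *m X *m y) 0 0.

Lemma bilin_tr m n (X : 'M[R]_(m, n)) x y : bilin X x y = bilin X^T y x.
Proof.
have -> : bilin X^T y x = (x^T *m X *m y)^T 0 0.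
  by rewrite /bilin !trmx_mul trmxK mulmxA.
by rewrite mxE.
Qed.

Lemma bilinDl m n (X : 'M[R]_(m, n)) x y z :
  bilin X (x + y) z = bilin X x z + bilin X y z.
Proof. by rewrite /bilin [(x + y)^T]linearD/= !mulmxDl mxE. Qed.

Lemma bilinDr m n (X : 'M[R]_(m, n)) x y z :
  bilin X z (x + y) = bilin X z x + bilin X z y.
Proof. by rewrite /bilin mulmxDr mxE. Qed.

Lemma quadE n (X : 'M[R]_n) x : quad X x = bilin X x x.
Proof. by []. Qed.

Lemma quadD n (X : 'M[R]_n) x y : X^T = X ->
  quad X (x + y) = quad X x + quad X y + 2 * bilin X x y.
Proof.
move=> XT; rewrite !quadE !(bilinDl, bilinDr) (bilin_tr X y x) XT; ring.
Qed.

Lemma quadN n (X : 'M[R]_n) x : quad X (- x) = quad X x.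
Proof. by rewrite /quad [(- x)^T]linearN/= !mulNmx mulmxN opprK. Qed.

Lemma quadB n (X : 'M[R]_n) x y : X^T = X ->
  quad X (x - y) = quad X x + quad X y - 2 * bilin X x y.
Proof.
move=> XT; rewrite quadD// quadN; congr (_ + _).
by rewrite /bilin mulmxN mxE mulrN.
Qed.

Lemma quad0 n (X : 'M[R]_n) : quad X 0 = 0.
Proof. by rewrite /quad mulmx0 mxE. Qed.

Lemma quadDl n (X Y : 'M[R]_n) x : quad (X + Y) x = quad X x + quad Y x.
Proof. by rewrite /quad mulmxDr mulmxDl mxE. Qed.

Lemma quad_congr m n (X : 'M[R]_n) (P : 'M[R]_(n, m)) y :
  quad (P^T *m X *m P) y = quad X (P *m y).
Proof. by rewrite /quad trmx_mul !mulmxA. Qed.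

Lemma quad_block_diag m n (X : 'M[R]_m) (Y : 'M[R]_n) x y :
  quad (block_mx X 0 0 Y) (col_mx x y) = quad X x + quad Y y.
Proof.
rewrite /quad tr_col_mx mul_row_block !mulmx0 addr0 add0r mul_row_col.
by rewrite mxE.
Qed.

(** * Symmetric positive-definite matrices *)

Section spd_matrix.
Context (n : nat) (X : 'M[R]_n) (spdX : spd X).

Lemma spd_ge0 x : 0 <= quad X x.
Proof.
have [->|/(proj2 spdX)/ltW//] := eqVneq x 0.
by rewrite quad0.
Qed.

Lemma spd_eq0 x : quad X x <= 0 -> x = 0.
Proof.
move=> qx; apply/eqP; apply: contraTT qx => /(proj2 spdX).
by rewrite -ltNge.
Qed.

Lemma spd_unit : X \in unitmx.
Proof.
rewrite -row_free_unit -kermx_eq0; apply/rowV0P => v /sub_kermxP vX.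
apply: trmx_inj; rewrite trmx0; apply: spd_eq0.
by rewrite /quad trmxK vX mul0mx mxE.
Qed.

(** Both signs follow by expanding the nonnegative values of the form at [x + y] and [x - y]. *)
Lemma spd_young x y : `|2 * bilin X x y| <= quad X x + quad X y.
Proof.
have := spd_ge0 (x + y); have := spd_ge0 (x - y).
rewrite quadB ?quadD ?(proj1 spdX)// => h1 h2.
by rewrite ler_norml; apply/andP; split; lra.
Qed.

Lemma spd_quadD_le x y : quad X (x + y) <= 2 * (quad X x + quad X y).
Proof.
have := spd_ge0 (x - y); rewrite quadB ?quadD ?(proj1 spdX)//; lra.
Qed.

Lemma spd_quadB_le x y : quad X (x - y) <= 2 * (quad X x + quad X y).
Proof. by rewrite -(quadN _ y); exact: spd_quadD_le. Qed.

Lemma spd_inv : spd (invmx X).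
Proof.
split; first by rewrite trmx_inv (proj1 spdX).
move=> x x0; have XU := spd_unit.
(* The inverse is congruent to [X] by an invertible matrix, so it inherits positivity. *)
have -> : invmx X = (invmx X)^T *m X *m invmx X.
  by rewrite trmx_inv (proj1 spdX) mulVmx// mul1mx.
rewrite quad_congr; apply: (proj2 spdX); apply: contra_neq x0 => iXx.
by rewrite -(mulKVmx XU x) iXx mulmx0.
Qed.

End spd_matrix.

Lemma spd_block_diag m n (X : 'M[R]_m) (Y : 'M[R]_n) :
  spd X -> spd Y -> spd (block_mx X 0 0 Y).
Proof.
move=> sX sY; split.
  by rewrite tr_block_mx !trmx0 (proj1 sX) (proj1 sY).
move=> x; rewrite -(vsubmxK x) quad_block_diag => x0.
rewrite ltNge; apply: contra_neqN x0 => le0.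
have qx := spd_ge0 sX (usubmx x); have qy := spd_ge0 sY (dsubmx x).
rewrite (spd_eq0 sX (x := usubmx x)); last lra.
by rewrite (spd_eq0 sY (x := dsubmx x)) ?col_mx0//; lra.
Qed.

(** Serves to derive the positivity of the diagonal of the mass matrix from its spectral equivalence
    with that matrix. *)
Lemma spd_of_le n (X Y : 'M[R]_n) (c : R) : 0 < c -> X^T = X -> spd Y ->
  (forall x, quad Y x <= c * quad X x) -> spd X.
Proof.
move=> c0 XT sY YX; split=> // x /(proj2 sY) Yx.
by rewrite -(pmulr_rgt0 _ c0); exact: lt_le_trans (YX x).
Qed.

Lemma trmx_diagonal_part n (X : 'M[R]_n) :
  (diagonal_part X)^T = diagonal_part X.
Proof. exact: tr_diag_mx. Qed.

(** Since [a] is positive, 0 is not an eigenvalue and the infinite case is excluded; [a] and [b]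
    then bound the infimum and the supremum. *)
Lemma condition_number_le n (X : 'M[R]_n) (a b : R) : 0 < a -> 0 <= b ->
  (forall l, eigenvalue X l -> a <= `|l| <= b) ->
  (condition_number X <= (b / a)%:E)%E.
Proof.
move=> a0 b0 Xab; rewrite /condition_number.
case: ifPn => [/Xab|_]; first by rewrite normr0 leNgt a0.
rewrite lee_fin; set S := (X in sup X).
(* For an empty spectrum, [sup] takes its default value 0, and so does the quotient. *)
have [->|S0] := eqVneq S set0.
  by rewrite sup0 mul0r divr_ge0// ltW.
have /set0P Sn := S0.
have aS : a <= inf S.
  by apply: lb_le_inf => // _ [l /Xab/andP[? _] <-].
have Sb : sup S <= b.
  by apply: ge_sup => // _ [l /Xab/andP[_ ?] <-].
rewrite (le_trans (y := b / inf S))//.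
  by rewrite ler_wpM2r// invr_ge0 (le_trans (ltW a0)).
by rewrite ler_wpM2l// lef_pV2 ?posrE// (lt_le_trans a0).
Qed.

(* [eigenvalue] refers to row eigenvectors; for symmetric [A] and [B],
   [u = B^-1 v^T] turns such a [v] into a solution of the generalized
   eigenvalue problem for columns. *)
Lemma eigenvalue_pencil n (A B : 'M[R]_n) (l : R) :
    A^T = A -> B^T = B -> B \in unitmx -> eigenvalue (invmx B *m A) l ->
  exists2 u : 'cV[R]_n, u != 0 & A *m u = l *: (B *m u).
Proof.
move=> AT BT BU /eigenvalueP[v vE v0]; exists (invmx B *m v^T).
  apply: contra_neq v0 => Bv; apply: trmx_inj.
  by rewrite -(mulKVmx BU v^T) Bv mulmx0 trmx0.
rewrite mulKVmx// -[A]AT -{1}BT -trmx_inv -!trmx_mul -mulmxA vE.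
by rewrite linearZ.
Qed.

End quadratic_forms.

(** * Eigenvalue bounds for the preconditioned saddle-point matrix *)

Section saddle_point.
Context (R : realType) (n m : nat).
Variables (M Mt : 'M[R]_n) (W Sh : 'M[R]_m) (D : 'M[R]_(m, n)).
Variables (c0 c1 d0 d1 : R).
Hypotheses (M_spd : spd M) (Mt_spd : spd Mt) (W_spd : spd W) (Sh_spd : spd Sh).
Hypotheses (c0_gt0 : 0 < c0) (c1_ge0 : 0 <= c1).
Hypotheses (d0_gt0 : 0 < d0) (d1_ge0 : 0 <= d1).
Hypothesis M_equiv :
  forall x, c0 * quad Mt x <= quad M x <= c1 * quad Mt x.
Hypothesis Sh_equiv :
  forall y, d0 * quad (schur M W D) y <= quad Sh y <= d1 * quad (schur M W D) y.

Section eigenpair.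
Variables (x t : 'cV[R]_n) (y : 'cV[R]_m) (l : R).
Hypothesis xy_neq0 : col_mx x y != 0.
Hypothesis eq1 : M *m x + D^T *m y = l *: (Mt *m x).
Hypothesis eq2 : D *m x - invmx W *m y = l *: (Sh *m y).
Hypothesis M_t : M *m t = D^T *m y.

Let bilin_t z : bilin D y z = bilin M t z.
Proof.
by rewrite /bilin -[in RHS](proj1 M_spd) -trmx_mul M_t trmx_mul trmxK.
Qed.

(** As [t = M^-1 D^T y], the term [D M^-1 D^T] of the Schur complement contributes
    [y^T D t = t^T M t]. *)
Let quadS : quad (schur M W D) y = quad (invmx W) y + quad M t.
Proof.
rewrite /schur quadDl; congr (_ + _).
have -> : quad M t = bilin D y t by rewrite bilin_t.
by rewrite /bilin /quad -(mulKmx (spd_unit M_spd) t) M_t !mulmxA.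
Qed.

Let eq1_tested z : bilin M z x + bilin M z t = l * bilin Mt z x.
Proof.
have /(congr1 (fun u => (z^T *m u) 0 0)) := eq1.
by rewrite -M_t mulmxDr -scalemxAr !mulmxA [LHS]mxE [RHS]mxE.
Qed.

Let eq2_tested : bilin M t x - quad (invmx W) y = l * quad Sh y.
Proof.
have /(congr1 (fun u => (y^T *m u) 0 0)) := eq2.
rewrite mulmxBr -scalemxAr !mulmxA [LHS]mxE [X in _ + X]mxE [RHS]mxE.
by rewrite -bilin_t.
Qed.

Let bilin_sym z w : bilin M z w = bilin M w z.
Proof. by rewrite bilin_tr (proj1 M_spd). Qed.

Let quadW_ge0 : 0 <= quad (invmx W) y.
Proof. exact/spd_ge0/spd_inv. Qed.

Lemma eigenvalue_le : `|l| <= 2 * c1 + d0^-1.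
Proof.
have /andP[_ Mx] := M_equiv x; have /andP[Sy _] := Sh_equiv y.
have Mtx := spd_ge0 Mt_spd x; have Shy := spd_ge0 Sh_spd y.
have Q_gt0 : 0 < quad Mt x + quad Sh y.
  by rewrite -quad_block_diag; exact: (proj2 (spd_block_diag Mt_spd Sh_spd)).
have Mx0 := spd_ge0 M_spd x; have W0 := quadW_ge0; have Mt0 := spd_ge0 M_spd t.
have lQ : l * (quad Mt x + quad Sh y) =
    quad M x + 2 * bilin M t x - quad (invmx W) y.
  have := eq1_tested x; rewrite (bilin_sym x t).
  rewrite -!/(quad _ _) mulrDr -eq2_tested => <-.
  by rewrite /quad /bilin; ring.
have := spd_young M_spd t x; rewrite ler_norml => /andP[h1 h2].
have Sy' : quad (schur M W D) y <= d0^-1 * quad Sh y.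
  by rewrite ler_pdivlMl.
have d0V : 0 < d0^-1 by rewrite invr_gt0.
rewrite -(ler_pM2r Q_gt0) -{1}(gtr0_norm Q_gt0) -normrM lQ.
(* Young's inequality bounds the cross term by [x^T M x + t^T M t]; the [t] part and the [W^-1] part
   together make up the Schur form. *)
apply: (@le_trans _ _ (2 * quad M x + quad (schur M W D) y)).
  by rewrite quadS ler_norml; apply/andP; split; lra.
(* These are the nonnegative cross terms in the product of [2 * c1 + d0^-1] with the sum of the two
   forms. *)
have := mulr_ge0 c1_ge0 Shy; have := mulr_ge0 (ltW d0V) Mtx; lra.
Qed.

Lemma eigenvalue_ge : (2 / c0 + d1)^-1 <= `|l|.
Proof.
pose r := x + t; pose E := quad M r + quad (schur M W D) y.
have /andP[_ Shy] := Sh_equiv y.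
have Shy0 := spd_ge0 Sh_spd y.
have W0 := quadW_ge0; have Mr0 := spd_ge0 M_spd r; have Mt0 := spd_ge0 M_spd t.
(* If [E] vanished, so would [y], [t] and [r], hence also [x = r - t], against [xy_neq0]. *)
have E_gt0 : 0 < E.
  rewrite ltNge; apply: contra_neqN xy_neq0; rewrite /E quadS => E0.
  have y0 : y = 0 by apply: (spd_eq0 (spd_inv W_spd)); lra.
  have t0 : t = 0 by apply: (spd_eq0 M_spd); lra.
  have r0 : r = 0 by apply: (spd_eq0 M_spd); lra.
  by move: r0; rewrite /r t0 addr0 => ->; rewrite y0 col_mx0.
have Mle z : quad Mt z <= c0^-1 * quad M z.
  by rewrite ler_pdivlMl//; case/andP: (M_equiv z).
(* Subtracting the tested equations leaves the cross term [t^T M (r - x)], which is [t^T M t] and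
   completes the Schur form. *)
have El : E = l * (bilin Mt (r + t) x - quad Sh y).
  rewrite mulrBr -eq1_tested -eq2_tested /E quadS.
  rewrite !quadE /r !(bilinDl, bilinDr) (bilin_sym x t); ring.
(* Both [r + t] and [x = r - t] have [M]-form at most [2 * E], so at most [2 / c0 * E] in [Mt];
   Young's inequality then bounds the bilinear term by [2 / c0 * E], and [Sh_equiv] adds
   [d1 * E]. *)
have FE : `|bilin Mt (r + t) x - quad Sh y| <= (2 / c0 + d1) * E.
  have := spd_young Mt_spd (r + t) x.
  have := Mle x; have := Mle (r + t).
  have : quad M (r + t) <= 2 * E.
    apply: le_trans (spd_quadD_le M_spd _ _) _; rewrite /E quadS; lra.
  have : quad M x <= 2 * E.
    have -> : x = r - t by rewrite /r addrK.
    apply: le_trans (spd_quadB_le M_spd _ _) _; rewrite /E quadS; lra.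
  set b := bilin _ _ _ => hx hrt mrt mx hb.
  have {}mx : quad Mt x <= 2 * (c0^-1 * E).
    by rewrite (le_trans mx)// mulrCA ler_pM2l ?invr_gt0.
  have {}mrt : quad Mt (r + t) <= 2 * (c0^-1 * E).
    by rewrite (le_trans mrt)// mulrCA ler_pM2l ?invr_gt0.
  have {}Shy : quad Sh y <= d1 * E.
    by rewrite (le_trans Shy)// ler_wpM2l// /E lerDr.
  have d1E := mulr_ge0 d1_ge0 (ltW E_gt0).
  by move: hb; rewrite !ler_norml => /andP[? ?]; apply/andP; split; lra.
have C_gt0 : 0 < 2 / c0 + d1 by rewrite ltr_wpDr// divr_gt0.
(* Taking absolute values in [El] and inserting [FE] bounds [E] by [|l| (2 / c0 + d1) E]; the
   positive [E] cancels. *)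
rewrite -[leLHS]mul1r ler_pdivrMr// -(ler_pM2r E_gt0) mul1r -mulrA.
rewrite -{1}(gtr0_norm E_gt0) {1}El normrM.
by rewrite ler_wpM2l.
Qed.

End eigenpair.

Lemma saddle_condition_number :
  (condition_number (invmx (block_mx Mt 0 0 Sh) *m saddle M W D)
    <= ((2 * c1 + d0^-1) / (2 / c0 + d1)^-1)%:E)%E.
Proof.
have C_gt0 : 0 < 2 / c0 + d1 by rewrite ltr_wpDr// divr_gt0.
apply: condition_number_le => [||l].
- by rewrite invr_gt0.
- by rewrite addr_ge0 ?mulr_ge0// invr_ge0 ltW.
have B_spd := spd_block_diag Mt_spd Sh_spd.
move=> /(eigenvalue_pencil _ (proj1 B_spd) (spd_unit B_spd))[].
  rewrite tr_block_mx trmxK (proj1 M_spd) linearN/=.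
  by rewrite (proj1 (spd_inv W_spd)).
move=> u; rewrite -(vsubmxK u) => u0.
rewrite !mul_block_col !mul0mx addr0 add0r scale_col_mx mulNmx.
move=> /eq_col_mx[eq1 eq2].
(* This fixes the witness [t = M^-1 D^T y] for the two eigenvalue bounds. *)
have M_t := mulKVmx (spd_unit M_spd) (D^T *m dsubmx u).
by rewrite (eigenvalue_ge u0 eq1 eq2 M_t) (eigenvalue_le u0 eq1 eq2 M_t).
Qed.

End saddle_point.

Theorem proposition5 (R : realType) (d : nat) (hd : (d = 2 \/ d = 3)%N)
    (Omega : set 'rV[R]_d) (alpha beta : 'rV[R]_d -> R)
    (I : Type) (h : I -> discretization Omega)
    (M_spd : forall i, spd (rt_mass (h i) beta))
    (W_spd : forall i, spd (w_mass (h i) alpha))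
    (M_diag : spectrally_equivalent
       (fun i => rt_mass (h i) beta)
       (fun i => diagonal_part (rt_mass (h i) beta)))
    (D : forall i, 'M[R]_(nvol (h i), nface (h i)))
    (D_div : forall i, is_div_matrix (D i))
    (Shat : forall i, 'M[R]_(nvol (h i)))
    (Shat_spd : forall i, spd (Shat i))
    (Shat_equiv : spectrally_equivalent
       Shat
       (fun i => schur (rt_mass (h i) beta) (w_mass (h i) alpha) (D i))) :
  exists K : R, forall i,
    let A := saddle (rt_mass (h i) beta) (w_mass (h i) alpha) (D i) in
    let B := block_mx (diagonal_part (rt_mass (h i) beta)) 0 0 (Shat i) in
    (condition_number (invmx B *m A) <= K%:E)%E.
Proof.
have [c0 [c1 [c0_gt0 c1_gt0 Mc]]] := M_diag.
have [d0 [d1 [d0_gt0 d1_gt0 Sd]]] := Shat_equiv.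
(* The bound involves only the equivalence constants, which are chosen before the index [i]; hence
   it is uniform. *)
exists ((2 * c1 + d0^-1) / (2 / c0 + d1)^-1) => i /=.
apply: saddle_condition_number => //.
- apply: (spd_of_le c1_gt0 (trmx_diagonal_part _) (M_spd i)) => x.
  by case/andP: (Mc i x).
- exact: ltW.
- exact: ltW.
Qed.
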